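(* Let $A\in C_b^1([0,\infty),\mathbb{R}^{d,d})$, i.e., $A(\cdot)$ and $\dot A(\cdot)$ are continuous and bounded. Then there exist constants $C,h_0>0$ such that $$\big|\alpha_s^{\mathrm{step}}(h,T,V)-\alpha_s^{\mathrm{cont}}(T,V)\big|\le C h$$ holds for all $V\in\mathcal{G}(s,d)$, for all $T>0$ and for all $h=\frac{T}{N}\le h_0$, where $N\in\mathbb{N}$.
   Context: $\mathcal{G}(s,d)$, $s\in\{1,\dots,d\}$, is the set of $s$-dimensional subspaces of $\mathbb{R}^d$. For $V,W\in\mathcal{G}(s,d)$, $\measuredangle(V,W)\in[0,\frac{\pi}{2}]$ is the maximal principal angle: $\measuredangle(V,W)=\arccos(\sigma_s)$, where $\sigma_1\ge\dots\ge\sigma_s\ge0$ are the singular values of $V_B^\top W_B$ and the columns of $V_B,W_B\in\mathbb{R}^{d,s}$ are orthonormal bases of $V,W$. $P_V$ is the orthogonal projector onto $V$ and $\|\cdot\|$ is the spectral norm. $\Phi(t,\tau)$ denotes the solution operator of the linear system $\dot u(t)=A(t)u(t)$, $t\ge0$, i.e. $u(t)=\Phi(t,\tau)u_0$ is the solution with $u(\tau)=u_0$. For $T>0$ and $V\in\mathcal{G}(s,d)$, $$\alpha_s^{\mathrm{cont}}(T,V)=\frac1T\int_0^T\big\|(I_d-P_{\Phi(t,0)V})A(t)P_{\Phi(t,0)V}\big\|\,dt,$$ $$\alpha_s^{\mathrm{step}}(h,T,V)=\frac1T\sum_{j=1}^{N}\measuredangle\big(\Phi((j-1)h,0)V,\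 \Phi(jh,0)V\big),\qquad h=\frac TN,\ N\in\mathbb{N}.$$ *)

(* Defs.v *)
From HB Require Import structures.
From mathcomp Require Import all_boot all_order all_algebra.
From mathcomp Require Import all_classical all_reals all_analysis.

Set Implicit Arguments.
Unset Strict Implicit.
Unset Printing Implicit Defensive.

Import Order.TTheory GRing.Theory Num.Theory.
Import numFieldNormedType.Exports.

Local Open Scope classical_set_scope.
Local Open Scope ring_scope.

Section LinearAlgebra.
Variable R : realType.

(* The norm `|x| that the library puts on matrices is the maximum norm, hence
   the explicit Euclidean norm. *)
Definition euclid_norm (d : nat) (x : 'cV[R]_d) : R :=
  Num.sqrt (\sum_(i < d) x i 0 ^+ 2).

Definition spectral_norm (d : nat) (M : 'M[R]_d) : R :=
  sup [set euclid_norm (M *m x) | x in [set x : 'cV[R]_d | euclid_norm x <= 1]].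

Definition orthonormal_basis (d s : nat) (V : {vspace 'cV[R]_d})
    (B : 'M[R]_(d, s)) : Prop :=
  B^T *m B = 1%:M /\ basis_of V [tuple col j B | j < s].

Definition orthonormal_basis_mx (d s : nat) (V : {vspace 'cV[R]_d}) :
  'M[R]_(d, s) := xget 0 (orthonormal_basis (s := s) V).

Definition is_orthogonal_projector (d : nat) (V : {vspace 'cV[R]_d})
    (P : 'M[R]_d) : Prop :=
  forall x : 'cV[R]_d,
    P *m x \in V /\ forall v, v \in V -> v^T *m (x - P *m x) = 0.

Definition orthogonal_projector (d : nat) (V : {vspace 'cV[R]_d}) : 'M[R]_d :=
  xget 0 (is_orthogonal_projector V).

(* [sv] lists the diagonal of some singular value decomposition of [M], in
   nonincreasing order and with multiplicities. *)
Definition are_singular_values (s : nat) (M : 'M[R]_s) (sv : s.-tuple R) : Prop :=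
  [/\ sorted (fun x y => y <= x) sv, (forall i, 0 <= tnth sv i) &
   exists U W : 'M[R]_s,
     [/\ U^T *m U = 1%:M, W^T *m W = 1%:M &
         M = U *m diag_mx (\row_i tnth sv i) *m W^T]].

Definition singular_values (s : nat) (M : 'M[R]_s) : s.-tuple R :=
  xget [tuple 0 | _ < s] (are_singular_values M).

(* Meaningful for subspaces of the same dimension [s > 0]; [nth] counts
   from 0, so that the entry of index [s.-1] is sigma_s. The singular values do
   not depend on the choice of the orthonormal bases. *)
Definition max_principal_angle (d s : nat) (V W : {vspace 'cV[R]_d}) : R :=
  acos (nth 0 (singular_values
    ((orthonormal_basis_mx s V)^T *m orthonormal_basis_mx s W)) s.-1).

Definition image_by (d : nat) (M : 'M[R]_d) (V : {vspace 'cV[R]_d}) :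
  {vspace 'cV[R]_d} := (linfun (mulmx M) @: V)%VS.

End LinearAlgebra.

Section LinearSystems.
Variable R : realType.

(* Derivative at [t >= 0] of a function on [0, +oo[; it is one-sided at
   [t = 0], and the values of [u] at negative arguments are irrelevant. *)
Definition has_derivative (m n : nat) (u : R -> 'M[R]_(m, n)) (t : R)
    (v : 'M[R]_(m, n)) : Prop :=
  (r - t)^-1 *: (u r - u t) @[r --> within `[0, +oo[ t^'] --> v.

Definition Cb1 (d : nat) (A : R -> 'M[R]_d) : Prop :=
  exists A' : R -> 'M[R]_d,
    [/\ (forall t, 0 <= t -> has_derivative A t (A' t)),
        {within `[0, +oo[, continuous A} /\ {within `[0, +oo[, continuous A'},
        [bounded A t | t in `[0, +oo[] & [bounded A' t | t in `[0, +oo[]].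

(* For all [tau >= 0] and [u0], [fun t => Phi t tau *m u0] is the solution on
   [0, +oo[ of u' = A u, u(tau) = u0. *)
Definition solution_operator (d : nat) (A : R -> 'M[R]_d)
    (Phi : R -> R -> 'M[R]_d) : Prop :=
  forall (tau : R) (u0 : 'cV[R]_d), 0 <= tau ->
    Phi tau tau *m u0 = u0 /\
    forall t, 0 <= t ->
      has_derivative (fun r => Phi r tau *m u0) t (A t *m (Phi t tau *m u0)).

Definition alpha_cont (d : nat) (A : R -> 'M[R]_d) (Phi : R -> R -> 'M[R]_d)
    (T : R) (V : {vspace 'cV[R]_d}) : R :=
  T^-1 * \int[lebesgue_measure]_(t in `[0, T])
    (let P := orthogonal_projector (image_by (Phi t 0) V) in
     spectral_norm ((1%:M - P) *m A t *m P)).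

(* The parameter [N] is the number of steps, so that the step size is
   [h = T / N]. *)
Definition alpha_step (d s : nat) (Phi : R -> R -> 'M[R]_d)
    (N : nat) (T : R) (V : {vspace 'cV[R]_d}) : R :=
  let h := T / N%:R in
  T^-1 * \sum_(1 <= j < N.+1)
    max_principal_angle s (image_by (Phi ((j%:R - 1) * h) 0) V)
                          (image_by (Phi (j%:R * h) 0) V).

End LinearSystems.

(* Main.v *)
Require Import Defs.
From HB Require Import structures.
From mathcomp Require Import all_boot all_order all_algebra.
From mathcomp Require Import all_classical all_reals all_analysis.
From mathcomp Require Import ring lra.
Import Order.TTheory GRing.Theory Num.Theory.
Import numFieldNormedType.Exports.
Local Open Scope ring_scope.

(** Write [V_t] for the image of [V] under the flow at time [t], [P_t] for the
    orthogonal projector onto it and [g t] for the spectral norm of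
    [(1 - P_t) A_t P_t], the integrand of [alpha_cont].

    Both averages are compared on one window [[a, b]] of length [h]. The sine of
    the largest principal angle between [V_a] and [V_b] is the spectral norm [S]
    of [(1 - P_a) P_b], that is, the largest distance to [V_a] of a unit vector
    of [V_b] ([max_principal_angleE]). Every [w] in [V_b] is the value at [b] of
    a solution whose value at [a] is some [v] in [V_a], and Taylor's formula
    [w = v + h A_a v + O(h^2)], uniform because [A] and its derivative are
    bounded ([solution_taylor]), gives
    [(1 - P_a) w = h (1 - P_a) A_a v + O(h^2)], because [1 - P_a] kills [v].
    As [v] and [w] range over the unit vectors up to a relative error [O(h)],
    this shows [S = h g a + O(h^2)] ([gap_le_velocity], [velocity_le_gap]).
    An angle and its sine [S = O(h)] differ by [O(h^2)] ([acos_sin_bounds]), so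
    the angle is [h g a + O(h^2)] ([angle_velocity]).

    On the other side, [P_t] is Lipschitz in [t] by the same estimates
    ([projector_diff]), hence so is [g], and the integral of [g] over the window
    is [h g a + O(h^2)] too. Summing over the [N = T / h] windows costs a factor
    [T / h], which the mean value over [[0, T]] turns into an error [O(h)]
    ([riemann_sum_error]). All the constants depend on [d] and on bounds for [A]
    and its derivative only.

    The principal angles are defined through a singular value decomposition and
    orthonormal bases chosen by [xget], so that their existence has to be shown
    ([svd_exists], [gram_schmidt]); and the subspaces [V_t] keep the dimension of
    [V] because a solution that vanishes once vanishes at time 0
    ([solution_eq0]). *)

Set Implicit Arguments.
Unset Strict Implicit.
Unset Printing Implicit Defensive.

(** * Euclidean norm and spectral norm *)

Section EuclideanNorm.
Variable R : realType.
Implicit Types d n : nat.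

Definition dot d (x y : 'cV[R]_d) : R := (x^T *m y) 0 0.

Lemma dotE d (x y : 'cV[R]_d) : dot x y = \sum_i x i 0 * y i 0.
Proof. by rewrite /dot mxE; apply: eq_bigr => i _; rewrite mxE. Qed.

Lemma dotC d (x y : 'cV[R]_d) : dot x y = dot y x.
Proof. by rewrite !dotE; apply: eq_bigr => i _; rewrite mulrC. Qed.

Lemma dotDr d (x y z : 'cV[R]_d) : dot x (y + z) = dot x y + dot x z.
Proof. by rewrite /dot mulmxDr mxE. Qed.

Lemma dotZr d a (x y : 'cV[R]_d) : dot x (a *: y) = a * dot x y.
Proof. by rewrite /dot -scalemxAr mxE. Qed.

Lemma dotNr d (x y : 'cV[R]_d) : dot x (- y) = - dot x y.
Proof. by rewrite -scaleN1r dotZr mulN1r. Qed.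

Lemma dotBr d (x y z : 'cV[R]_d) : dot x (y - z) = dot x y - dot x z.
Proof. by rewrite dotDr dotNr. Qed.

Lemma dotDl d (x y z : 'cV[R]_d) : dot (x + y) z = dot x z + dot y z.
Proof. by rewrite dotC dotDr !(dotC z). Qed.

Lemma dotZl d a (x y : 'cV[R]_d) : dot (a *: x) y = a * dot x y.
Proof. by rewrite dotC dotZr dotC. Qed.

Lemma dotBl d (x y z : 'cV[R]_d) : dot (x - y) z = dot x z - dot y z.
Proof. by rewrite dotC dotBr !(dotC z). Qed.

Lemma dot_mull m n (M : 'M[R]_(m, n)) x y : dot (M *m x) y = dot x (M^T *m y).
Proof. by rewrite /dot trmx_mul mulmxA. Qed.

Lemma euclid_norm_ge0 d (x : 'cV[R]_d) : 0 <= euclid_norm x.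
Proof. exact: sqrtr_ge0. Qed.

Lemma euclid_norm_sqr d (x : 'cV[R]_d) : euclid_norm x ^+ 2 = dot x x.
Proof.
rewrite sqr_sqrtr ?dotE; first by apply: eq_bigr => i _; rewrite expr2.
by apply: sumr_ge0 => i _; exact: sqr_ge0.
Qed.

Lemma euclid_norm_eq0 d (x : 'cV[R]_d) : euclid_norm x = 0 -> x = 0.
Proof.
move=> /eqP; rewrite sqrtr_eq0 => x0; apply/matrixP => i j.
have : \sum_i x i 0 ^+ 2 == 0.
  by rewrite eq_le x0 sumr_ge0// => k _; exact: sqr_ge0.
rewrite psumr_eq0 => [/allP/(_ i)|k _]; last exact: sqr_ge0.
by rewrite mem_index_enum sqrf_eq0 ord1 mxE => /(_ isT)/eqP.
Qed.

Lemma euclid_norm0 d : euclid_norm (0 : 'cV[R]_d) = 0.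
Proof.
by apply/eqP; rewrite -sqrf_eq0 euclid_norm_sqr /dot mulmx0 mxE.
Qed.

Lemma euclid_normZ d a (x : 'cV[R]_d) :
  euclid_norm (a *: x) = `|a| * euclid_norm x.
Proof.
rewrite /euclid_norm -sqrtr_sqr -sqrtrM ?sqr_ge0// mulr_sumr.
by congr Num.sqrt; apply: eq_bigr => i _; rewrite mxE exprMn.
Qed.

Lemma euclid_normN d (x : 'cV[R]_d) : euclid_norm (- x) = euclid_norm x.
Proof. by rewrite -scaleN1r euclid_normZ normrN1 mul1r. Qed.

Lemma euclid_normB d (x y : 'cV[R]_d) :
  euclid_norm (x - y) = euclid_norm (y - x).
Proof. by rewrite -euclid_normN opprB. Qed.

(** The squared norm of [|y| x - |x| y] is [2 |x| |y| (|x| |y| - dot x y)]. *)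
Lemma cauchy_schwarz d (x y : 'cV[R]_d) :
  dot x y <= euclid_norm x * euclid_norm y.
Proof.
set a := euclid_norm x; set b := euclid_norm y.
have [a0|a0] := eqVneq a 0.
  by rewrite (euclid_norm_eq0 a0) dotE big1 ?a0 ?mul0r// => i _; rewrite mxE mul0r.
have [b0|b0] := eqVneq b 0.
  by rewrite (euclid_norm_eq0 b0) dotE big1 ?b0 ?mulr0// => i _; rewrite mxE mulr0.
have ap : 0 < a by rewrite lt_def a0 euclid_norm_ge0.
have bp : 0 < b by rewrite lt_def b0 euclid_norm_ge0.
have := sqr_ge0 (euclid_norm (b *: x - a *: y)).
rewrite euclid_norm_sqr !(dotBr, dotBl, dotZr, dotZl) (dotC y x) -!euclid_norm_sqr.
rewrite -/a -/b.
rewrite [X in 0 <= X](_ : _ = (2 * (a * b)) * (a * b - dot x y)); last by ring.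
by rewrite pmulr_rge0 ?subr_ge0// mulr_gt0// mulr_gt0.
Qed.

Lemma le_euclid_norm d n (x : 'cV[R]_d) (y : 'cV[R]_n) :
  dot x x <= dot y y -> euclid_norm x <= euclid_norm y.
Proof.
by rewrite -!euclid_norm_sqr ler_sqr// nnegrE; exact: euclid_norm_ge0.
Qed.

Lemma eq_euclid_norm d n (x : 'cV[R]_d) (y : 'cV[R]_n) :
  dot x x = dot y y -> euclid_norm x = euclid_norm y.
Proof.
by move=> e; apply/eqP; rewrite eq_le !le_euclid_norm// e.
Qed.

Lemma euclid_normD d (x y : 'cV[R]_d) :
  euclid_norm (x + y) <= euclid_norm x + euclid_norm y.
Proof.
rewrite -ler_sqr ?nnegrE ?addr_ge0 ?euclid_norm_ge0//.
rewrite euclid_norm_sqr !(dotDr, dotDl) (dotC y x) -!euclid_norm_sqr.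
have := cauchy_schwarz x y; nra.
Qed.

Lemma ler_euclid_normB d (x y : 'cV[R]_d) :
  euclid_norm x - euclid_norm y <= euclid_norm (x - y).
Proof. by rewrite lerBlDr; have := euclid_normD (x - y) y; rewrite subrK. Qed.

Lemma coord_le_euclid_norm d (x : 'cV[R]_d) i : `|x i 0| <= euclid_norm x.
Proof.
rewrite -ler_sqr ?nnegrE ?euclid_norm_ge0// real_normK ?num_real//.
rewrite euclid_norm_sqr dotE (bigD1 i)//= expr2 lerDl.
by apply: sumr_ge0 => j _; rewrite -expr2 sqr_ge0.
Qed.

Lemma euclid_norm_le_coord d (x : 'cV[R]_d) c : (forall i, `|x i 0| <= c) ->
  euclid_norm x <= d%:R * c.
Proof.
case: d x => [|d] x xc; first by rewrite mul0r /euclid_norm big_ord0 sqrtr0.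
have c0 : 0 <= c by rewrite (le_trans _ (xc ord0)).
rewrite -ler_sqr ?nnegrE ?euclid_norm_ge0 ?mulr_ge0// euclid_norm_sqr dotE.
apply: (@le_trans _ _ (\sum_(i < d.+1) c ^+ 2)).
  apply: ler_sum => i _; rewrite -expr2 -[_ ^+ 2]real_normK ?num_real//.
  by rewrite ler_sqr ?nnegrE.
rewrite sumr_const card_ord -[_ *+ _]mulr_natl exprMn ler_wpM2r ?sqr_ge0//.
by rewrite -natrX ler_nat leq_pmulr.
Qed.

(** The constants here and in [euclid_norm_le_coord] are crude: any bound in terms
    of the dimension does. *)
Lemma euclid_norm_mulmx_entry d (M : 'M[R]_d) a : (forall i j, `|M i j| <= a) ->
  forall x, euclid_norm (M *m x) <= d%:R * (d%:R * a) * euclid_norm x.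
Proof.
move=> Ma x; rewrite -mulrA; apply: euclid_norm_le_coord => i.
rewrite mxE (le_trans (ler_norm_sum _ _ _))//.
have -> : d%:R * a * euclid_norm x = \sum_(j < d) a * euclid_norm x.
  by rewrite sumr_const card_ord -[(_ * _) *+ d]mulr_natl mulrA.
by apply: ler_sum => j _; rewrite normrM ler_pM// coord_le_euclid_norm.
Qed.

Lemma spectral_norm_has_sup d (M : 'M[R]_d) :
  has_sup [set euclid_norm (M *m x) | x in [set x : 'cV[R]_d | euclid_norm x <= 1]]%classic.
Proof.
split; first by exists (euclid_norm (M *m 0)), 0 => //=; rewrite euclid_norm0.
pose a := \sum_i \sum_j `|M i j|.
have Ma i j : `|M i j| <= a.
  rewrite /a (bigD1 i)//= (bigD1 j)//= -addrA lerDl addr_ge0 ?sumr_ge0// => k _.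
  by rewrite sumr_ge0.
exists (d%:R * (d%:R * a)) => _ [x /= x1 <-].
apply: (le_trans (euclid_norm_mulmx_entry Ma x)).
rewrite -[leRHS]mulr1 ler_wpM2l// !mulr_ge0//.
by rewrite sumr_ge0// => k _; rewrite sumr_ge0.
Qed.

Lemma spectral_norm_ge0 d (M : 'M[R]_d) : 0 <= spectral_norm M.
Proof.
apply: (le_trans (euclid_norm_ge0 (M *m 0))).
apply: sup_upper_bound; first exact: spectral_norm_has_sup.
by exists 0 => //=; rewrite euclid_norm0.
Qed.

Lemma spectral_norm_ub d (M : 'M[R]_d) x :
  euclid_norm (M *m x) <= spectral_norm M * euclid_norm x.
Proof.
have [x0|x0] := eqVneq (euclid_norm x) 0.
  by rewrite (euclid_norm_eq0 x0) mulmx0 euclid_norm0 mulr0.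
have xp : 0 < euclid_norm x by rewrite lt_def x0 euclid_norm_ge0.
rewrite -ler_pdivrMr// mulrC.
apply: sup_upper_bound; first exact: spectral_norm_has_sup.
exists ((euclid_norm x)^-1 *: x) => /=.
  by rewrite euclid_normZ ger0_norm ?invr_ge0 ?euclid_norm_ge0// mulVf.
by rewrite -scalemxAr euclid_normZ ger0_norm// invr_ge0 euclid_norm_ge0.
Qed.

Lemma spectral_norm_le d (M : 'M[R]_d) c : 0 <= c ->
  (forall x, euclid_norm (M *m x) <= c * euclid_norm x) -> spectral_norm M <= c.
Proof.
move=> c0 Mc; apply: ge_sup; first by have [] := spectral_norm_has_sup M.
by move=> _ [x /= x1 <-]; rewrite (le_trans (Mc x))// -[leRHS]mulr1 ler_wpM2l.
Qed.

Lemma spectral_norm_lip d (M N : 'M[R]_d) c : 0 <= c ->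
  (forall x, euclid_norm ((M - N) *m x) <= c * euclid_norm x) ->
  `|spectral_norm M - spectral_norm N| <= c.
Proof.
move=> c0 MNc; rewrite ler_distl; apply/andP; split.
  rewrite lerBlDr; apply: spectral_norm_le => [|x].
    by rewrite addr_ge0 ?spectral_norm_ge0.
  have -> : N *m x = M *m x - (M - N) *m x by rewrite mulmxBl opprB addrC subrK.
  apply: (le_trans (euclid_normD _ _)); rewrite euclid_normN mulrDl.
  by rewrite lerD ?spectral_norm_ub.
apply: spectral_norm_le => [|x]; first by rewrite addr_ge0 ?spectral_norm_ge0.
have -> : M *m x = N *m x + (M - N) *m x by rewrite mulmxBl addrC subrK.
by apply: (le_trans (euclid_normD _ _)); rewrite mulrDl lerD ?spectral_norm_ub.
Qed.

End EuclideanNorm.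

(** * Orthonormal bases and orthogonal projectors *)

Section OrthonormalBases.
Variable R : realType.
Implicit Types d k n : nat.

Lemma mulmx_sum_col m n (B : 'M[R]_(m, n)) (y : 'cV[R]_n) :
  B *m y = \sum_j y j 0 *: col j B.
Proof.
apply/matrixP => i j; rewrite ord1 mxE summxE.
by apply: eq_bigr => k _; rewrite !mxE mulrC.
Qed.

Lemma mulmx_in_vspace d k (V : {vspace 'cV[R]_d}) (B : 'M[R]_(d, k)) y :
  (forall j, col j B \in V) -> B *m y \in V.
Proof. by move=> BV; rewrite mulmx_sum_col memv_suml// => j _; rewrite memvZ. Qed.

Lemma euclid_norm_isometry d k (B : 'M[R]_(d, k)) y :
  B^T *m B = 1%:M -> euclid_norm (B *m y) = euclid_norm y.
Proof.
by move=> BB; apply: eq_euclid_norm; rewrite dot_mull mulmxA BB mul1mx.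
Qed.

(** The transpose of an isometric embedding has the same norm: [|B^T z|^2] is
    [dot z (B B^T z)]. *)
Lemma euclid_norm_trmx_isometry d k (B : 'M[R]_(d, k)) z :
  B^T *m B = 1%:M -> euclid_norm (B^T *m z) <= euclid_norm z.
Proof.
move=> BB; have [->|z0] := eqVneq (euclid_norm (B^T *m z)) 0.
  exact: euclid_norm_ge0.
have zp : 0 < euclid_norm (B^T *m z) by rewrite lt_def z0 euclid_norm_ge0.
rewrite -(ler_pM2r zp) -expr2 euclid_norm_sqr dot_mull trmxK.
by rewrite (le_trans (cauchy_schwarz _ _))// euclid_norm_isometry.
Qed.

(** Gram-Schmidt: a vector of [V] outside the span of the columns found so far
    exists for reasons of dimension; its component orthogonal to them,
    normalized, is the next column. *)
Lemma gram_schmidt d k (V : {vspace 'cV[R]_d}) : (k <= \dim V)%N ->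
  exists B : 'M[R]_(d, k), B^T *m B = 1%:M /\ forall j, col j B \in V.
Proof.
elim: k => [|k IH] kV.
  by exists 0; split; [apply/matrixP; case|case].
have [B [BB BV]] := IH (ltnW kV).
have /subvPn[v vV vB] : ~~ (V <= <<[tuple col j B | j < k]>>)%VS.
  apply: contraL kV => /dimvS; rewrite -leqNgt => /leq_trans; apply.
  by rewrite (leq_trans (dim_span _))// size_tuple.
have BvN y : v != B *m y.
  apply: contraNneq vB => ->; rewrite mulmx_in_vspace// => j.
  by rewrite memv_span//; apply/tnthP; exists j; rewrite tnth_mktuple.
pose w := v - B *m (B^T *m v).
have wp : 0 < euclid_norm w.
  rewrite lt_def euclid_norm_ge0 andbT; apply/eqP => /euclid_norm_eq0/eqP.
  by rewrite subr_eq0 (negbTE (BvN _)).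
have Bw : B^T *m w = 0 by rewrite mulmxBr !mulmxA BB mul1mx subrr.
rewrite -addn1; exists (row_mx B ((euclid_norm w)^-1 *: w)); split.
  rewrite tr_row_mx mul_col_row scalar_mx_block BB -!scalemxAr Bw scaler0.
  have -> : ((euclid_norm w)^-1 *: w)^T *m B = 0.
    by apply: trmx_inj; rewrite trmx_mul trmxK trmx0 -scalemxAr Bw scaler0.
  congr block_mx; rewrite linearZ/= -scalemxAl scalerA [w^T *m w]mx11_scalar.
  rewrite -/(dot w w) -euclid_norm_sqr scale_scalar_mx expr2 mulrA.
  by rewrite mulfVK ?mulVf// gt_eqF.
move=> j; case: (splitP j) => i ji.
  have -> : j = lshift 1 i by exact: val_inj.
  by rewrite colKl.
have -> : j = rshift k i by exact: val_inj.
rewrite colKr ord1 col_id memvZ// rpredB// mulmx_in_vspace//.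
Qed.

Lemma orthonormal_basisP d s (V : {vspace 'cV[R]_d}) : \dim V = s ->
  orthonormal_basis V (orthonormal_basis_mx s V).
Proof.
move=> Vs; have [|B [BB BV]] := @gram_schmidt d s V; first by rewrite Vs.
apply: (xgetPex 0 (P := orthonormal_basis (s := s) V)); exists B; split=> //.
rewrite basisEfree size_tuple Vs leqnn andbT; apply/andP; split; last first.
  by apply/span_subvP => _ /tnthP[j ->]; rewrite tnth_mktuple.
apply/freeP => c c0 i.
have : B *m (\col_j c j) = 0.
  rewrite mulmx_sum_col -[RHS]c0; apply: eq_bigr => j _.
  by rewrite mxE (nth_map j) ?size_enum_ord// nth_ord_enum.
move/(congr1 (mulmx B^T)); rewrite mulmxA BB mul1mx mulmx0 => /matrixP/(_ i 0).
by rewrite !mxE.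
Qed.

Lemma orthonormal_basis_mem d s (V : {vspace 'cV[R]_d}) (B : 'M[R]_(d, s)) y :
  orthonormal_basis V B -> B *m y \in V.
Proof.
move=> [_ bV]; apply: mulmx_in_vspace => j; apply: (basis_mem bV).
by apply/tnthP; exists j; rewrite tnth_mktuple.
Qed.

Lemma orthonormal_basis_coord d s (V : {vspace 'cV[R]_d}) (B : 'M[R]_(d, s)) v :
  orthonormal_basis V B -> v \in V -> exists y, v = B *m y.
Proof.
move=> [_ bV] vV; exists (\col_j coord [tuple col j B | j < s] j v).
rewrite mulmx_sum_col {1}(coord_basis bV vV); apply: eq_bigr => j _.
by rewrite mxE (nth_map j) ?size_enum_ord// nth_ord_enum.
Qed.

End OrthonormalBases.

Section OrthogonalProjectors.
Variables (R : realType) (d : nat) (V : {vspace 'cV[R]_d}).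
Let P := orthogonal_projector V.

Lemma orthogonal_projectorP : is_orthogonal_projector V P.
Proof.
apply: (xgetPex 0 (P := is_orthogonal_projector V)).
pose B := orthonormal_basis_mx (\dim V) V.
have bB : orthonormal_basis V B by exact: orthonormal_basisP.
have [BB _] := bB.
exists (B *m B^T) => x; split; first by rewrite -mulmxA orthonormal_basis_mem.
move=> v /(orthonormal_basis_coord bB)[y ->].
by rewrite trmx_mul mulmxBr -!mulmxA [B^T *m (B *m _)]mulmxA BB mul1mx subrr.
Qed.

Lemma proj_mem x : P *m x \in V.
Proof. by have [] := orthogonal_projectorP x. Qed.

Lemma proj_orth v x : v \in V -> dot v (x - P *m x) = 0.
Proof.
by have [_ /[apply]] := orthogonal_projectorP x; rewrite /dot => ->; rewrite mxE.
Qed.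

Lemma proj_id v : v \in V -> P *m v = v.
Proof.
move=> vV; apply/esym/eqP; rewrite -subr_eq0; apply/eqP/euclid_norm_eq0.
by apply/eqP; rewrite -sqrf_eq0 euclid_norm_sqr proj_orth// rpredB// proj_mem.
Qed.

Lemma proj_compl (x : 'cV[R]_d) : (1%:M - P) *m x = x - P *m x.
Proof. by rewrite mulmxBl mul1mx. Qed.

Lemma proj_pythagoras x :
  euclid_norm x ^+ 2 = euclid_norm (P *m x) ^+ 2
                       + euclid_norm ((1%:M - P) *m x) ^+ 2.
Proof.
rewrite proj_compl !euclid_norm_sqr.
have o := proj_orth x (proj_mem x).
have {1 2}-> : x = P *m x + (x - P *m x) by rewrite addrC subrK.
move: (x - _) o => y o.
by rewrite !(dotDl, dotDr) (dotC y) o addr0 add0r.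
Qed.

Lemma proj_le x : euclid_norm (P *m x) <= euclid_norm x.
Proof.
rewrite -ler_sqr ?nnegrE ?euclid_norm_ge0// [leRHS]proj_pythagoras.
by rewrite lerDl sqr_ge0.
Qed.

Lemma proj_compl_le x : euclid_norm ((1%:M - P) *m x) <= euclid_norm x.
Proof.
rewrite -ler_sqr ?nnegrE ?euclid_norm_ge0// [leRHS]proj_pythagoras.
by rewrite lerDr sqr_ge0.
Qed.

(** The point of [V] closest to [x] is its projection. *)
Lemma proj_compl_dist x v : v \in V ->
  euclid_norm ((1%:M - P) *m x) <= euclid_norm (x - v).
Proof.
move=> vV; rewrite (le_trans _ (proj_compl_le _))//.
by rewrite !proj_compl mulmxBr (proj_id vV) opprB addrA subrK.
Qed.

Lemma proj_sym x y : dot (P *m x) y = dot x (P *m y).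
Proof.
transitivity (dot (P *m x) (P *m y)).
  by apply/eqP; rewrite -subr_eq0 -dotBr proj_orth ?proj_mem.
by apply/esym/eqP; rewrite -subr_eq0 -dotBl dotC proj_orth ?proj_mem.
Qed.

End OrthogonalProjectors.

(** * Singular value decomposition *)

Section SingularValues.
Variable R : realType.
Implicit Types d k n s : nat.

Let continuous_sum n m (F : 'I_m -> 'rV[R]_n -> R) :
  (forall i, continuous (F i)) -> continuous (fun v => \sum_i F i v).
Proof.
by move=> Fc; apply: continuous_big => // -[a b]; exact: add_continuous.
Qed.

Lemma continuous_normsq_mulmx n (M : 'M[R]_n) :
  continuous (fun v : 'rV[R]_n => dot (M *m v^T) (M *m v^T)).
Proof.
have -> : (fun v : 'rV[R]_n => dot (M *m v^T) (M *m v^T)) =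
    fun v => \sum_i (\sum_j M i j * v 0 j) * (\sum_j M i j * v 0 j).
  apply/funext => v; rewrite dotE; apply: eq_bigr => i _.
  by congr (_ * _); rewrite mxE; apply: eq_bigr => j _; rewrite mxE.
have c i : continuous (fun v : 'rV[R]_n => \sum_j M i j * v 0 j).
  apply: (@continuous_sum _ _ (fun j v => M i j * v 0 j)) => j v.
  by apply: continuousM; [exact: cst_continuous|exact: coord_continuous].
apply: (@continuous_sum _ _ (fun i v => (\sum_j M i j * v 0 j) * _)) => i v.
by apply: continuousM; exact: c.
Qed.

(** The unit sphere is compact. *)
Lemma exists_maximal_vector n (M : 'M[R]_n.+1) : exists x : 'cV[R]_n.+1,
  euclid_norm x = 1 /\
  forall y, euclid_norm (M *m y) <= euclid_norm (M *m x) * euclid_norm y.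
Proof.
pose sphere := [set v : 'rV[R]_n.+1 | dot v^T v^T = 1]%classic.
have sphere1 v : sphere v <-> euclid_norm v^T = 1.
  rewrite /sphere/= -euclid_norm_sqr; split=> [/eqP|->]; last by rewrite expr1n.
  by rewrite sqrf_eq1 => /orP[/eqP//|/eqP e]; have := euclid_norm_ge0 v^T;
     rewrite e; lra.
have sphere0 : (sphere !=set0)%classic.
  exists (delta_mx 0 0); rewrite /sphere/= /dot trmxK trmx_delta.
  by rewrite mul_delta_mx mxE.
have compS : compact sphere.
  have cI : compact [set v : 'rV[R]_n.+1 | forall i, v ord0 i \in `[(-1), 1]%R]%classic.
    by apply: (@rV_compact _ _ (fun=> `[(-1) : R, 1]%classic)) => _; exact: segment_compact.
  apply: subclosed_compact cI _ => [|v /sphere1 v1 i /=].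
    have /continuous_closedP/(_ [set (1 : R)]%classic) :=
      @continuous_normsq_mulmx n.+1 (1%:M : 'M[R]_n.+1).
    under [X in (X @^-1` _)%classic]funext do rewrite mul1mx.
    by apply; exact: closed_eq.
  by rewrite in_itv/= -ler_norml -v1; have := coord_le_euclid_norm v^T i; rewrite mxE.
have [v /set_mem/sphere1 v1 vmax] :=
  compact_EVT_max sphere0 compS (continuous_subspaceT (@continuous_normsq_mulmx _ M)).
exists v^T; split=> // y.
have [y0|y0] := eqVneq (euclid_norm y) 0.
  by rewrite (euclid_norm_eq0 y0) mulmx0 euclid_norm0 mulr0.
have yp : 0 < euclid_norm y by rewrite lt_def y0 euclid_norm_ge0.
pose z := (euclid_norm y)^-1 *: y.
have z1 : euclid_norm z = 1.
  by rewrite euclid_normZ ger0_norm ?mulVf// invr_ge0 euclid_norm_ge0.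
have /vmax : z^T \in sphere by apply/mem_set/sphere1; rewrite trmxK.
rewrite trmxK => /le_euclid_norm.
rewrite -scalemxAr euclid_normZ ger0_norm ?invr_ge0 ?euclid_norm_ge0//.
by rewrite ler_pdivrMl// mulrC.
Qed.

(** The orthogonal complement of [x] is the kernel of a linear form, so that it
    has room for [n] orthonormal vectors. *)
Lemma orthogonal_completion n (x : 'cV[R]_n.+1) : euclid_norm x = 1 ->
  exists B : 'M[R]_(n.+1, n), B^T *m B = 1%:M /\ x^T *m B = 0.
Proof.
move=> x1; pose f := linfun (mulmx x^T : 'cV[R]_n.+1 -> 'M[R]_1).
have [|B [BB Bx]] := @gram_schmidt R n.+1 n (lker f).
  have := limg_ker_dim f fullv; rewrite capfv dimvf => e.
  have fle : (\dim (f @: fullv) <= 1)%N.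
    by rewrite (leq_trans (dimvS (subvf _)))// dimvf /dim/= muln1.
  rewrite -(leq_add2r (\dim (limg f))) e /dim/= muln1.
  by rewrite (leq_trans (leq_add (leqnn n) fle))// addn1.
exists B; split=> //; apply/matrixP => i j.
have := Bx j; rewrite memv_ker lfunE/= => /eqP xBj.
transitivity ((x^T *m col j B) i 0); last by rewrite xBj !mxE.
by rewrite !mxE; apply: eq_bigr => k _; rewrite !mxE.
Qed.

Lemma orthogonal_row_mx n (x : 'cV[R]_n.+1) (B : 'M[R]_(n.+1, n)) :
  euclid_norm x = 1 -> B^T *m B = 1%:M -> x^T *m B = 0 ->
  (row_mx x B : 'M[R]_(1 + n))^T *m row_mx x B = 1%:M :> 'M[R]_(1 + n).
Proof.
move=> x1 BB xB; rewrite tr_row_mx mul_col_row BB.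
have Bx0 : B^T *m x = 0 by apply: trmx_inj; rewrite trmx_mul trmxK trmx0.
rewrite xB Bx0 scalar_mx_block [x^T *m x]mx11_scalar -/(dot x x).
by rewrite -euclid_norm_sqr x1 expr1n.
Qed.

End SingularValues.

Section SingularValueDecomposition.
Variable R : realType.
Implicit Types d k n s : nat.

Lemma euclid_norm_delta n (i : 'I_n) :
  euclid_norm (delta_mx i 0 : 'cV[R]_n) = 1.
Proof.
apply/eqP; rewrite -(@eqrXn2 _ 2) ?euclid_norm_ge0// euclid_norm_sqr expr1n.
by rewrite /dot trmx_delta mul_delta_mx mxE !eqxx.
Qed.

Lemma singular_vector n (M : 'M[R]_n) sv : are_singular_values M sv ->
  forall i, exists x, euclid_norm x = 1 /\ euclid_norm (M *m x) = tnth sv i.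
Proof.
move=> [_ sv0 [U [W [UU WW ->]]]] i; exists (W *m delta_mx i 0).
rewrite (euclid_norm_isometry _ WW) euclid_norm_delta; split=> //.
rewrite -!mulmxA (euclid_norm_isometry _ UU) [W^T *m _]mulmxA WW mul1mx.
have -> : diag_mx (\row_j tnth sv j) *m delta_mx i 0 =
    tnth sv i *: (delta_mx i 0 : 'cV_n).
  by rewrite mul_diag_mx; apply/matrixP => j l; rewrite !mxE ord1;
     case: eqP => [->|]//; rewrite !mulr0.
by rewrite euclid_normZ euclid_norm_delta mulr1 ger0_norm.
Qed.

(** By induction: a unit vector [x] with [a = |M x|] maximal, and the unit vector
    [u] with [M x = a u], are the first singular vectors. In orthonormal bases
    starting with [x] and [u] the matrix becomes block diagonal: its first column
    is [a e_1] by the choice of [u], and its first row because maximality forces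
    [M^T u = a x]. The other block has norm at most [a], so its singular values
    continue a nonincreasing list. *)
Lemma svd_exists n (M : 'M[R]_n) : exists sv, are_singular_values M sv.
Proof.
elim: n M => [|n IH] M.
  exists [tuple]; split; [by []|by case|exists 1%:M, 1%:M].
  by split; apply/matrixP => -[].
have [x [x1 xmax]] := exists_maximal_vector M.
set a := euclid_norm (M *m x) in xmax.
have a0 : 0 <= a by exact: euclid_norm_ge0.
have [u u1 Mx] : exists2 u, euclid_norm u = 1 & M *m x = a *: u.
  have [az|az] := eqVneq a 0.
    (* [M] is zero, so that any unit vector does for [u]. *)
    by exists x; rewrite // az scale0r; exact: euclid_norm_eq0.
  exists (a^-1 *: (M *m x)); last by rewrite scalerA mulfV ?scale1r.
  by rewrite euclid_normZ ger0_norm ?invr_ge0// mulVf.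
(* [|M^T u| <= a], and then [|M^T u - a x|^2 <= a^2 - 2 a (dot u (M x)) + a^2 = 0]. *)
have Mu : M^T *m u = a *: x.
  have [Mu0|Mu0] := eqVneq (euclid_norm (M^T *m u)) 0.
    have : dot (M *m x) u = a by rewrite Mx dotZl -euclid_norm_sqr u1 expr1n mulr1.
    rewrite dot_mull (euclid_norm_eq0 Mu0) /dot mulmx0 mxE => <-.
    by rewrite scale0r.
  have Mule : euclid_norm (M^T *m u) <= a.
    have Mup : 0 < euclid_norm (M^T *m u) by rewrite lt_def Mu0 euclid_norm_ge0.
    rewrite -(ler_pM2r Mup) -expr2 euclid_norm_sqr dot_mull trmxK.
    by rewrite (le_trans (cauchy_schwarz _ _))// u1 mul1r.
  apply/eqP; rewrite -subr_eq0; apply/eqP/euclid_norm_eq0/eqP.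
  rewrite -sqrf_eq0 eq_le sqr_ge0 andbT euclid_norm_sqr.
  rewrite !(dotBl, dotBr, dotZl, dotZr) (dotC x) -!euclid_norm_sqr x1.
  rewrite [dot _ x]dot_mull trmxK Mx dotZr -euclid_norm_sqr u1.
  have : euclid_norm (M^T *m u) ^+ 2 <= a ^+ 2.
    by rewrite ler_sqr// nnegrE euclid_norm_ge0.
  by lra.
have [U [UU uU]] := orthogonal_completion u1.
have [W [WW xW]] := orthogonal_completion x1.
have [sv svM] := IH (U^T *m M *m W).
have [svs sv0 [U2 [W2 [U2U W2W M2]]]] := svM.
exists [tuple of a :: sv]; split.
- rewrite /= path_sortedE; last by move=> p q r /= qp pr; exact: le_trans pr qp.
  rewrite svs andbT; apply/allP => _ /tnthP[i ->].
  have [y [y1 <-]] := singular_vector svM i.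
  rewrite -!mulmxA (le_trans (euclid_norm_trmx_isometry _ UU))//.
  by rewrite (le_trans (xmax _))// (euclid_norm_isometry _ WW) y1 mulr1.
- by move=> i; case: (unliftP ord0 i) => [j ->|->]; rewrite ?tnthS ?tnth0.
pose X : 'M[R]_(1 + n) := row_mx u U; pose Y : 'M[R]_(1 + n) := row_mx x W.
have XX : X^T *m X = 1%:M by exact: orthogonal_row_mx.
have YY : Y^T *m Y = 1%:M by exact: orthogonal_row_mx.
have blk_orth (Z : 'M[R]_n) : Z^T *m Z = 1%:M ->
    (block_mx 1%:M 0 0 Z : 'M[R]_(1 + n))^T *m block_mx 1%:M 0 0 Z = 1%:M.
  move=> ZZ; rewrite tr_block_mx mulmx_block !trmx0 !mulmx0 !mul0mx trmx1 mul1mx.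
  by rewrite !addr0 add0r ZZ -scalar_mx_block.
exists (X *m (block_mx 1%:M 0 0 U2 : 'M[R]_(1 + n))).
exists (Y *m (block_mx 1%:M 0 0 W2 : 'M[R]_(1 + n))).
split.
- by rewrite trmx_mul mulmxA -[_ *m X^T *m X]mulmxA XX mulmx1 blk_orth.
- by rewrite trmx_mul mulmxA -[_ *m Y^T *m Y]mulmxA YY mulmx1 blk_orth.
have D : diag_mx (\row_i tnth [tuple of a :: sv] i) =
    block_mx (diag_mx a%:M) 0 0 (diag_mx (\row_i tnth sv i)) :> 'M[R]_(1 + n).
  rewrite -diag_mx_row; congr diag_mx.
  apply/rowP => i; rewrite mxE; case: (unliftP ord0 i) => [j ->|->].
    by rewrite tnthS -[lift _ _]rshift1 row_mxEr mxE.
  rewrite tnth0 (_ : ord0 = lshift n (ord0 : 'I_1)); last exact: val_inj.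
  by rewrite row_mxEl mxE eqxx.
have XMY : X^T *m M *m Y = block_mx (diag_mx a%:M) 0 0 (U^T *m M *m W).
  rewrite /X /Y tr_row_mx mul_col_mx mul_col_row.
  have uM : u^T *m M = a *: x^T by rewrite -[LHS]trmxK trmx_mul trmxK Mu linearZ.
  have -> : U^T *m M *m x = 0.
    rewrite -mulmxA Mx -scalemxAr; apply: trmx_inj.
    by rewrite trmx0 linearZ/= trmx_mul trmxK uU scaler0.
  rewrite uM -!scalemxAl xW scaler0 [x^T *m x]mx11_scalar -/(dot x x).
  rewrite -euclid_norm_sqr x1 expr1n; congr block_mx.
  by apply/matrixP => i j; rewrite !mxE !ord1 !eqxx mulr1 mulr1n.
rewrite D; have {D}-> : M = X *m (X^T *m M *m Y) *m Y^T.
  by rewrite !mulmxA (mulmx1C XX) mul1mx -mulmxA (mulmx1C YY) mulmx1.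
have -> : X^T *m M *m Y = block_mx 1%:M 0 0 U2 *m
    block_mx (diag_mx a%:M) 0 0 (diag_mx (\row_i tnth sv i)) *m
    (block_mx 1%:M 0 0 W2)^T.
  rewrite XMY M2 tr_block_mx !mulmx_block.
  by rewrite !(mulmx0, mul0mx, trmx0, addr0, add0r, trmx1, mul1mx, mulmx1).
by rewrite trmx_mul !mulmxA.
Qed.

End SingularValueDecomposition.

(** * The largest principal angle and its sine *)

Section AngleBetweenSubspaces.
Variable R : realType.
Implicit Types d k n s : nat.

Lemma smallest_singular_value n (M : 'M[R]_n) sv : are_singular_values M sv ->
  forall x, nth 0 sv n.-1 * euclid_norm x <= euclid_norm (M *m x).
Proof.
case: n M sv => [|n] M sv svM x.
  by rewrite {1}/euclid_norm big_ord0 sqrtr0 mulr0 euclid_norm_ge0.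
have [svs sv0 [U [W [UU WW ->]]]] := svM; set sigma := nth 0 sv n.+1.-1.
have sigma_le i : sigma <= tnth sv i.
  rewrite (tnth_nth 0)/=.
  apply: (sorted_leq_nth (leT := fun x y => y <= x)) svs _ _ _ _ _.
  - by move=> p q r /= qp pr; exact: le_trans pr qp.
  - by move=> p /=.
  - by rewrite inE size_tuple.
  - by rewrite inE size_tuple.
  - by rewrite -ltnS.
have sigma0 : 0 <= sigma.
  by rewrite (le_trans (sv0 ord_max))// (tnth_nth 0).
rewrite -!mulmxA (euclid_norm_isometry _ UU).
have WW' : W^T^T *m W^T = 1%:M by rewrite trmxK; exact: mulmx1C.
rewrite -(euclid_norm_isometry x WW'); move: (W^T *m x) => y.
rewrite -ler_sqr ?nnegrE ?mulr_ge0 ?euclid_norm_ge0//.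
rewrite exprMn !euclid_norm_sqr !dotE mulr_sumr; apply: ler_sum => i _.
rewrite mul_diag_mx !mxE -!expr2 exprMn ler_wpM2r ?sqr_ge0//.
by rewrite ler_sqr ?nnegrE.
Qed.

(** Let [B] and [C] have orthonormal bases of [V] and [W] as columns. If
    [w = C y] is a unit vector of [W], then [B^T C y] has the length of the
    projection of [w] to [V]. So [sigma], the smallest singular value, is the
    least such length, and by Pythagoras the largest distance [S] of such a [w]
    to [V] satisfies [S^2 = 1 - sigma^2]. *)
Lemma max_principal_angleE d s (V W : {vspace 'cV[R]_d}) : (0 < s)%N ->
  \dim V = s -> \dim W = s ->
  let S := spectral_norm ((1%:M - orthogonal_projector V) *m
                          orthogonal_projector W) in
  exists sigma, [/\ 0 <= sigma, sigma ^+ 2 + S ^+ 2 = 1 &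
    max_principal_angle s V W = acos sigma].
Proof.
move=> s0 Vs Ws S.
have bV := orthonormal_basisP Vs; have bW := orthonormal_basisP Ws.
rewrite /max_principal_angle.
move: (orthonormal_basis_mx s V) (orthonormal_basis_mx s W) bV bW.
move=> B C bB bC; have [BB _] := bB; have [CC _] := bC.
set M := B^T *m C.
have svM : are_singular_values M (singular_values M).
  exact: (xgetPex [tuple 0 | _ < s] (svd_exists M)).
have normM y : euclid_norm (M *m y) =
    euclid_norm (orthogonal_projector V *m (C *m y)).
  have [z Pz] := orthonormal_basis_coord bB (proj_mem V (C *m y)).
  rewrite Pz (euclid_norm_isometry _ BB); congr euclid_norm.
  have -> : z = B^T *m (orthogonal_projector V *m (C *m y)).
    by rewrite Pz mulmxA BB mul1mx.
  rewrite /M -mulmxA; apply/eqP; rewrite -subr_eq0 -mulmxBr; apply/eqP.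
  apply/matrixP => i j; rewrite [j]ord1.
  have := proj_orth (C *m y) (orthonormal_basis_mem (delta_mx i 0) bB).
  rewrite dot_mull /dot trmx_delta -rowE !mxE => {2}<-.
  by apply: eq_bigr => l _; rewrite !mxE.
have pyth y : euclid_norm (M *m y) ^+ 2 +
    euclid_norm ((1%:M - orthogonal_projector V) *m (C *m y)) ^+ 2
    = euclid_norm y ^+ 2.
  by rewrite normM -proj_pythagoras (euclid_norm_isometry _ CC).
have s1 : (s.-1 < s)%N by rewrite prednK.
exists (nth 0 (singular_values M) s.-1).
have [y [y1 yS]] := singular_vector svM (Ordinal s1).
rewrite (tnth_nth 0)/= in yS.
have sig0 : 0 <= nth 0 (singular_values M) s.-1 by rewrite -yS euclid_norm_ge0.
split=> //; apply/eqP; rewrite eq_le; apply/andP; split; last first.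
  have := pyth y; rewrite yS y1 expr1n => <-; rewrite lerD2l.
  rewrite ler_sqr ?nnegrE ?euclid_norm_ge0 ?spectral_norm_ge0//.
  have := spectral_norm_ub ((1%:M - orthogonal_projector V) *m
                             orthogonal_projector W) (C *m y).
  rewrite -mulmxA (proj_id (orthonormal_basis_mem _ bC)).
  by rewrite (euclid_norm_isometry _ CC) y1 mulr1.
have sig1 : nth 0 (singular_values M) s.-1 ^+ 2 <= 1.
  by have := pyth y; rewrite yS y1 expr1n => <-; rewrite lerDl sqr_ge0.
rewrite -lerBrDl -[leRHS]sqr_sqrtr ?subr_ge0//.
rewrite ler_sqr ?nnegrE ?sqrtr_ge0 ?spectral_norm_ge0//.
apply: spectral_norm_le => [|x]; first exact: sqrtr_ge0.
have [z Pz] := orthonormal_basis_coord bC (proj_mem W x).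
apply: le_trans (ler_wpM2l (sqrtr_ge0 _) (proj_le W x)).
rewrite -mulmxA Pz (euclid_norm_isometry _ CC).
rewrite -ler_sqr ?nnegrE ?mulr_ge0 ?sqrtr_ge0 ?euclid_norm_ge0//.
rewrite exprMn [X in _ <= X * _]sqr_sqrtr ?subr_ge0//.
have : nth 0 (singular_values M) s.-1 ^+ 2 * euclid_norm z ^+ 2 <=
    euclid_norm (M *m z) ^+ 2.
  rewrite -exprMn ler_sqr ?nnegrE ?mulr_ge0 ?euclid_norm_ge0//.
  exact: smallest_singular_value.
by have := pyth z; lra.
Qed.

(** By the mean value theorem [sin t = t cos c] for some [c] in [[0, t]], where
    the cosine decreases. *)
Lemma sin_secant (t : R) : 0 <= t <= pi -> t * cos t <= sin t <= t.
Proof.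
move=> /andP[t0 tpi].
have sincont : ({within `[0, t], continuous (@sin R)})%classic.
  by apply: continuous_subspaceT; exact: continuous_sin.
have [c + e] := MVT_segment t0 (fun x _ => is_derive_sin x) sincont.
rewrite in_itv/= => /andP[c0 ct].
move: e; rewrite sin0 !subr0 => ->; rewrite [leLHS]mulrC; apply/andP; split.
  rewrite ler_wpM2r// leNgt ltr_cos ?in_itv/= ?c0 ?t0 ?tpi ?(le_trans ct)//.
  by rewrite -leNgt.
by rewrite -[leRHS]mul1r ler_wpM2r// cos_le1.
Qed.

(** Here [S] is the sine of the angle [t = acos sigma], so that
    [t (1 - S^2) <= t sigma <= S]; as [t <= 1], this gives [t <= S + S^2]. *)
Lemma acos_sin_bounds (sigma S : R) : 0 <= sigma -> 0 <= S <= 1 / 2 ->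
  sigma ^+ 2 + S ^+ 2 = 1 -> S <= acos sigma <= S + S ^+ 2.
Proof.
move=> sig0 /andP[S0 S1] e.
have sig1 : -1 <= sigma <= 1.
  by apply/andP; split; [lra|rewrite -(@ler_pXn2r _ 2)// ?nnegrE// expr1n; nra].
have := sin_secant (t := acos sigma).
rewrite acos_ge0// acos_lepi// sin_acos// acosK// => /(_ isT).
have -> : 1 - sigma ^+ 2 = S ^+ 2 by lra.
rewrite sqrtr_sqr ger0_norm// => /andP[tS ->].
have t0 := acos_ge0 sig1; move: (acos sigma) t0 tS => t t0 tS /=.
have h : t * (1 - S ^+ 2) <= S by rewrite (le_trans _ tS)// ler_wpM2l//; nra.
have S4 : S ^+ 2 <= 1 / 4 by nra.
have t1 : t <= 1 by nra.
have : t * S ^+ 2 <= S ^+ 2 by rewrite ler_piMl// sqr_ge0.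
by lra.
Qed.

End AngleBetweenSubspaces.

(** * Derivatives on the half-line *)

Section HalfLineDerivatives.
Local Open Scope classical_set_scope.
Local Open Scope ring_scope.
Variable R : realType.
Implicit Types (f : R -> R) (t : R).

(** Differentiability relative to the half-line, with the denominator cleared, so
    that the estimate also holds for [r = t] and yields continuity at once. *)
Definition has_slope f t l := forall e, 0 < e -> exists2 delta, 0 < delta &
  forall r, 0 <= r -> `|r - t| < delta ->
    `|f r - f t - (r - t) * l| <= e * `|r - t|.

Lemma has_derivative_entry m n (u : R -> 'M[R]_(m, n)) t v i j :
  has_derivative u t v -> has_slope (fun r => u r i j) t (v i j).
Proof.
move=> ut e e0.
have /cvgrPdist_lt/(_ e e0) :
    (fun r => ((r - t)^-1 *: (u r - u t)) i j) @
      within `[0, +oo[ t^' --> v i j.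
  apply: (cvg_comp _ (fun M : 'M[R]_(m, n) => M i j) ut).
  exact: coord_continuous.
rewrite near_withinE => -[delta /= d0 dl]; exists delta => // r r0 rt.
have [->|rnt] := eqVneq r t; first by rewrite !subrr mul0r subr0 normr0 mulr0.
have := dl r; rewrite /= distrC => /(_ rt rnt).
rewrite in_itv/= r0 !mxE => /(_ isT) lt_e.
have rt0 : r - t != 0 by rewrite subr_eq0.
have -> : u r i j - u t i j - (r - t) * v i j =
    - ((v i j - (r - t)^-1 * (u r i j - u t i j)) * (r - t)) by field.
by rewrite normrN normrM ler_wpM2r// ltW.
Qed.

Lemma has_slope_is_derive f t l : 0 < t -> has_slope f t l -> is_derive t 1 f l.
Proof.
move=> t0 fl.
have cv : h^-1 *: (f (h *: 1 + t) - f t) @[h --> 0^'] --> l.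
  apply/cvgrPdist_le => e e0; have [delta d0 fd] := fl e e0.
  near=> h.
  have h0 : h != 0 by near: h; exact: nbhs_dnbhs_neq.
  have hd : `|h| < delta by near: h; exact: dnbhs0_lt.
  have ht : `|h| < t by near: h; exact: dnbhs0_lt.
  have := fd (h *: 1 + t); rewrite [h *: 1]mulr1 addrK => /(_ _ hd).
  move: ht; rewrite ltr_norml => /andP[ht _].
  have ht0 : 0 <= h + t by lra.
  move=> /(_ ht0) fh.
  have -> : l - h^-1 *: (f (h + t) - f t) =
     - ((f (h + t) - f t - h * l) * h^-1) by rewrite /GRing.scale/=; field.
  by rewrite normrN normrM normfV ler_pdivrMr// normr_gt0.
apply: DeriveDef; first by apply/cvg_ex; exists l.
by apply: cvg_lim.
Unshelve. all: by end_near. Qed.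

Lemma has_slope_continuous f (f' : R -> R) a b : 0 <= a ->
  (forall t, 0 <= t -> has_slope f t (f' t)) ->
  {within `[a, b], continuous f}.
Proof.
move=> a0 ff'; apply/subspace_continuousP => t; rewrite /= in_itv/= => /andP[a_t tb].
have t0 := le_trans a0 a_t.
apply/cvgrPdist_lt => e e0; have [delta d0 fd] := ff' t t0 1 ltr01.
have M0 : 0 < 1 + `|f' t| by rewrite ltr_wpDr.
rewrite near_withinE; near=> r; rewrite /= in_itv/= => /andP[ar rb].
have rd : `|r - t| < delta.
  by rewrite distrC; near: r; exact: nbhsx_ballx.
have re : `|r - t| < e / (1 + `|f' t|).
  rewrite distrC; near: r; apply: nbhsx_ballx; rewrite divr_gt0//.
have {fd} := fd r (le_trans a0 ar) rd.
rewrite mul1r => fr; rewrite distrC.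
have -> : f r - f t = (f r - f t - (r - t) * f' t) + (r - t) * f' t by ring.
apply: le_lt_trans (ler_normD _ _) _.
move: re; rewrite ltr_pdivlMr// normrM; lra.
Unshelve. all: by end_near. Qed.

Lemma has_slope_MVT f (f' : R -> R) a b : 0 <= a <= b ->
  (forall t, 0 <= t -> has_slope f t (f' t)) ->
  exists2 c, a <= c <= b & f b - f a = f' c * (b - a).
Proof.
move=> /andP[a0 ab] ff'.
have [c cab e] : exists2 c, c \in `[a, b]%R & f b - f a = f' c * (b - a).
  apply: MVT_segment => //; last exact: has_slope_continuous ff'.
  move=> t; rewrite in_itv/= => /andP[a_t _].
  by apply: has_slope_is_derive (ff' _ _); rewrite ?ltW// (le_lt_trans a0).
by exists c => //; rewrite in_itv/= in cab.
Qed.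

End HalfLineDerivatives.

(** * Solutions of the linear system on a short window *)

Section LinearODE.
Local Open Scope classical_set_scope.
Local Open Scope ring_scope.
Variable R : realType.

Lemma entry_le_norm m n (M : 'M[R]_(m, n)) i j : `|M i j| <= `|M|.
Proof.
rewrite [leRHS]/Num.norm/= mx_normrE.
exact: (le_bigmax _ (fun ij : 'I_m * 'I_n => `|M ij.1 ij.2|) (i, j)).
Qed.

Lemma bounded_entries m n (F : R -> 'M[R]_(m, n)) :
  [bounded F t | t in `[0, +oo[] ->
  exists2 c, 0 <= c & forall t, 0 <= t -> forall i j, `|F t i j| <= c.
Proof.
move=> [c [_ Fc]]; exists (`|c| + 1); first by rewrite addr_ge0.
move=> t t0 i j; rewrite (le_trans (entry_le_norm _ _ _))//.
apply: (Fc (`|c| + 1)); last by rewrite /= in_itv/= t0.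
by rewrite (le_lt_trans (ler_norm c))// ltrDl.
Qed.

Variables (d : nat).

Lemma Cb1_bounds (A : R -> 'M[R]_d) : Cb1 A -> exists K L, [/\ 0 <= K, 0 <= L,
  (forall t, 0 <= t -> forall x, euclid_norm (A t *m x) <= K * euclid_norm x) &
  (forall t r, 0 <= t <= r -> forall x,
    euclid_norm ((A r - A t) *m x) <= L * (r - t) * euclid_norm x)].
Proof.
move=> [A' [AA' _ /bounded_entries[c c0 Ac] /bounded_entries[c' c'0 A'c]]].
exists (d%:R * (d%:R * c)), (d%:R * (d%:R * c')); split.
- by rewrite !mulr_ge0.
- by rewrite !mulr_ge0.
- by move=> t t0; apply: euclid_norm_mulmx_entry; exact: Ac.
move=> t r tr; rewrite (_ : _ * (r - t) = d%:R * (d%:R * (c' * (r - t)))).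
  apply: euclid_norm_mulmx_entry => i j.
  have [q /andP[tq _] e] := has_slope_MVT tr
    (fun t t0 => has_derivative_entry i j (AA' t t0)).
  have [t0 tr'] := andP tr.
  rewrite !mxE e normrM [`|r - t|]ger0_norm ?subr_ge0// ler_wpM2r ?subr_ge0//.
  by rewrite A'c// (le_trans t0).
by ring.
Qed.

(** Coordinatewise mean value theorem. *)
Lemma increment_le (u w : R -> 'cV[R]_d) p m a b : 0 <= a <= b ->
  (forall t, 0 <= t -> has_derivative u t (w t)) ->
  (forall c, a <= c <= b -> euclid_norm (w c - p) <= m) ->
  euclid_norm (u b - u a - (b - a) *: p) <= d%:R * ((b - a) * m).
Proof.
move=> /[dup] ab0 /andP[a0 ab] uw wm; apply: euclid_norm_le_coord => i.
have [t0 /wm tm e] := has_slope_MVT ab0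
  (fun t t0 => has_derivative_entry i 0 (uw t t0)).
have -> : (u b - u a - (b - a) *: p) i 0 = (b - a) * (w t0 - p) i 0.
  by rewrite !mxE e; ring.
rewrite normrM ger0_norm ?subr_ge0// ler_wpM2l ?subr_ge0//.
by rewrite (le_trans (coord_le_euclid_norm _ _)).
Qed.

Lemma has_derivative_max (u w : R -> 'cV[R]_d) a b : 0 <= a <= b ->
  (forall t, 0 <= t -> has_derivative u t (w t)) ->
  exists2 c, a <= c <= b &
    forall t, a <= t <= b -> euclid_norm (u t) <= euclid_norm (u c).
Proof.
move=> /andP[a0 ab] uw.
have ci i : {within `[a, b], continuous (fun r => u r i 0)}.
  exact: has_slope_continuous a0 (fun t t0 => has_derivative_entry i 0 (uw t t0)).
have cont : {within `[a, b], continuous (fun r => dot (u r) (u r))}.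
  rewrite (_ : (fun r => _) = fun r => \sum_i u r i 0 * u r i 0); last first.
    by apply/funext => r; rewrite dotE.
  apply: continuous_big => [|i _]; first by move=> -[x y]; exact: add_continuous.
  by move=> r; apply: continuousM; exact: ci.
have [c cab cmax] := EVT_max ab cont.
exists c; first by rewrite in_itv/= in cab.
by move=> t tab; apply/le_euclid_norm/cmax; rewrite in_itv.
Qed.

Variables (A : R -> 'M[R]_d) (K L : R).
Hypotheses (K0 : 0 <= K) (L0 : 0 <= L).
Hypothesis AK : forall t, 0 <= t ->
  forall x, euclid_norm (A t *m x) <= K * euclid_norm x.
Hypothesis AL : forall t r, 0 <= t <= r ->
  forall x, euclid_norm ((A r - A t) *m x) <= L * (r - t) * euclid_norm x.

Definition solution (u : R -> 'cV[R]_d) :=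
  forall t, 0 <= t -> has_derivative u t (A t *m u t).

(* Up to the factor [|u a|], [c1] is a Lipschitz constant of the solution and
   [c2], below, bounds the remainder of its Taylor formula. The factor [d] comes
   from the coordinatewise estimates, the factor 2 from [solution_window_le]. *)
Let c1 := 2 * d%:R * K.

Variables (u : R -> 'cV[R]_d) (a b : R).
Hypotheses (ab0 : 0 <= a <= b) (u_sol : solution u) (short : c1 * (b - a) <= 1 / 2).

Lemma c1_ge0 : 0 <= c1. Proof. by rewrite !mulr_ge0. Qed.

(** At a point [m] of the window where the norm is maximal, the mean value theorem
    gives [|u m - u a| <= |u m| / 4]. *)
Lemma solution_window_le c : a <= c <= b -> euclid_norm (u c) <= 2 * euclid_norm (u a).
Proof.
have [a0 ab] := andP ab0.
have [m /andP[am mb] mmax] := has_derivative_max ab0 u_sol.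
move=> /mmax/le_trans; apply.
have := @increment_le u (fun t => A t *m u t) 0 (K * euclid_norm (u m)) a m.
rewrite a0 am => /(_ isT u_sol); rewrite scaler0 subr0 => h.
have {}h : euclid_norm (u m - u a) <= d%:R * ((m - a) * (K * euclid_norm (u m))).
  apply: h => e /andP[ae em]; rewrite subr0.
  rewrite (le_trans (AK (le_trans a0 ae) _))// ler_wpM2l// mmax//.
  by rewrite ae (le_trans em).
have := le_trans (ler_euclid_normB _ _) h.
have : d%:R * ((m - a) * (K * euclid_norm (u m))) <= 1 / 4 * euclid_norm (u m).
  rewrite !mulrA ler_wpM2r ?euclid_norm_ge0//.
  have : c1 * (m - a) <= c1 * (b - a) by rewrite ler_wpM2l ?c1_ge0// lerB.
  move: short; rewrite /c1; lra.
have := euclid_norm_ge0 (u m); lra.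
Qed.

Lemma solution_increment c : a <= c <= b ->
  euclid_norm (u c - u a) <= c1 * (c - a) * euclid_norm (u a).
Proof.
have [a0 ab] := andP ab0 => /andP[ac cb].
have := @increment_le u (fun t => A t *m u t) 0 (K * (2 * euclid_norm (u a))) a c.
rewrite a0 ac => /(_ isT u_sol); rewrite scaler0 subr0 => h.
apply: (le_trans (h _)) => [e /andP[ae ec]|]; last by rewrite /c1; lra.
rewrite subr0 (le_trans (AK (le_trans a0 ae) _))// ler_wpM2l//.
by rewrite solution_window_le// ae (le_trans ec).
Qed.

Lemma solution_window_ge : euclid_norm (u a) <= 2 * euclid_norm (u b).
Proof.
have [a0 ab] := andP ab0.
have := solution_increment (c := b); rewrite ab lexx => /(_ isT) h.
have : c1 * (b - a) * euclid_norm (u a) <= 1 / 2 * euclid_norm (u a).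
  by rewrite ler_wpM2r ?euclid_norm_ge0.
by have := ler_euclid_normB (u a) (u b); rewrite euclid_normB; lra.
Qed.

Let c2 := d%:R * (2 * L + K * c1).

(** The velocity [A c *m u c] differs from [A a *m u a] by [O(b - a)], since both
    [A] and [u] are Lipschitz. *)
Lemma solution_taylor :
  euclid_norm (u b - u a - (b - a) *: (A a *m u a)) <=
  c2 * (b - a) ^+ 2 * euclid_norm (u a).
Proof.
have [a0 ab] := andP ab0.
apply: le_trans (increment_le
  (m := (2 * L + K * c1) * (b - a) * euclid_norm (u a)) ab0 u_sol _) _; last first.
  by rewrite /c2; lra.
move=> c /andP[ac cb].
have -> : A c *m u c - A a *m u a = (A c - A a) *m u c + A a *m (u c - u a).
  by rewrite mulmxBl mulmxBr addrA subrK.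
rewrite (le_trans (euclid_normD _ _))//.
rewrite [leRHS](_ : _ = L * (b - a) * (2 * euclid_norm (u a)) +
  K * (c1 * (b - a) * euclid_norm (u a))); last by ring.
have acb : a <= c <= b by rewrite ac.
rewrite lerD//.
  have ac0 : 0 <= a <= c by rewrite a0.
  rewrite (le_trans (AL ac0 _))//.
  rewrite ler_pM ?mulr_ge0 ?euclid_norm_ge0 ?subr_ge0//.
    by rewrite ler_wpM2l// lerB.
  by rewrite solution_window_le.
rewrite (le_trans (AK a0 _))// ler_wpM2l//.
rewrite (le_trans (solution_increment acb))// ler_wpM2r ?euclid_norm_ge0//.
by rewrite ler_wpM2l ?c1_ge0// lerB.
Qed.

End LinearODE.

(** * Subspaces one window apart *)

Section NearbySubspaces.
Variables (R : realType) (d : nat).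
Variables (V W : {vspace 'cV[R]_d}) (A : 'M[R]_d) (K h c1 c2 : R).
Hypotheses (h0 : 0 <= h) (c10 : 0 <= c1) (c20 : 0 <= c2) (K0 : 0 <= K).
Hypothesis AK : forall x, euclid_norm (A *m x) <= K * euclid_norm x.

(** All that is needed of the values [v] and [w] of one solution at the ends of a
    window of length [h]: they are [O(h)] apart, of comparable size, and [w] is
    an explicit Euler step from [v] up to [O(h^2)]. *)
Definition euler_step (v w : 'cV[R]_d) :=
  [/\ euclid_norm (w - v) <= c1 * h * euclid_norm v,
      euclid_norm v <= 2 * euclid_norm w &
      euclid_norm (w - v - h *: (A *m v)) <= c2 * h ^+ 2 * euclid_norm v].

Hypothesis stepVW : forall v, v \in V -> exists2 w, w \in W & euler_step v w.
Hypothesis stepWV : forall w, w \in W -> exists2 v, v \in V & euler_step v w.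

Let P := orthogonal_projector V.
Let Q := orthogonal_projector W.
Let S := spectral_norm ((1%:M - P) *m Q).
(* The speed at which [V] turns when its points move with velocity [A v]: only
   the component orthogonal to [V] of this velocity matters. *)
Let g := spectral_norm ((1%:M - P) *m A *m P).

Lemma dist_to_V w : w \in W ->
  euclid_norm ((1%:M - P) *m w) <= 2 * c1 * h * euclid_norm w.
Proof.
move=> /stepWV[v vV [wv vw _]].
rewrite (le_trans (proj_compl_dist _ vV))// (le_trans wv)//.
have : c1 * h * euclid_norm v <= c1 * h * (2 * euclid_norm w).
  by rewrite ler_wpM2l// mulr_ge0.
by lra.
Qed.

Lemma dist_to_W v : v \in V ->
  euclid_norm ((1%:M - Q) *m v) <= c1 * h * euclid_norm v.
Proof.
move=> /stepVW[w wW [wv _ _]].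
by rewrite (le_trans (proj_compl_dist _ wW))// euclid_normB.
Qed.

Lemma gap_le : S <= 2 * c1 * h.
Proof.
apply: spectral_norm_le => [|x]; first by rewrite !mulr_ge0.
rewrite -mulmxA (le_trans (dist_to_V (proj_mem W x)))//.
by rewrite ler_wpM2l ?mulr_ge0// proj_le.
Qed.

Lemma velocity_ge0 : 0 <= g. Proof. exact: spectral_norm_ge0. Qed.

Lemma velocity_le : g <= K.
Proof.
apply: spectral_norm_le => // x; rewrite -!mulmxA.
by rewrite (le_trans (proj_compl_le _ _))// (le_trans (AK _))// ler_wpM2l// proj_le.
Qed.

Lemma velocity_ub v : v \in V ->
  euclid_norm ((1%:M - P) *m (A *m v)) <= g * euclid_norm v.
Proof.
move=> vV; have -> : (1%:M - P) *m (A *m v) = ((1%:M - P) *m A *m P) *m v.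
  by rewrite -!mulmxA (proj_id vV).
exact: spectral_norm_ub.
Qed.

Lemma euler_step_proj v w : v \in V ->
  (1%:M - P) *m w = h *: ((1%:M - P) *m (A *m v)) +
                    (1%:M - P) *m (w - v - h *: (A *m v)).
Proof.
move=> vV; rewrite !mulmxBr -scalemxAr.
have -> : (1%:M - P) *m v = 0 by rewrite proj_compl (proj_id vV) subrr.
by rewrite subr0 addrCA subrr addr0.
Qed.

(** Bound the distance to [V] of a vector [w] of [W] by expanding [w] as an Euler
    step from some [v] in [V]; passing from [|v|] to [|w|] costs the factor
    [1 + 2 c1 h]. *)
Lemma gap_le_velocity : h <= 1 ->
  S <= h * g + (c2 + 2 * c1 * K + 2 * c1 * c2) * h ^+ 2.
Proof.
move=> h1; apply: le_trans (_ : (h * g + c2 * h ^+ 2) * (1 + 2 * c1 * h) <= _).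
  have g0 := velocity_ge0.
  have hg0 : 0 <= h * g + c2 * h ^+ 2.
    by rewrite addr_ge0 ?mulr_ge0// sqr_ge0.
  have k0 : 0 <= 1 + 2 * c1 * h by rewrite addr_ge0// !mulr_ge0.
  apply: spectral_norm_le => [|x]; first exact: mulr_ge0.
  apply: le_trans (ler_wpM2l (mulr_ge0 hg0 k0) (proj_le W x)).
  rewrite -mulmxA -/Q; have := proj_mem W x; rewrite -/Q.
  move: (Q *m x) => {x} w /stepWV[v vV [wv vw taylor]].
  rewrite (euler_step_proj w vV).
  apply: (le_trans (euclid_normD _ _)); rewrite euclid_normZ ger0_norm//.
  have step1 := ler_wpM2l h0 (velocity_ub vV).
  have step2 := le_trans (proj_compl_le V (w - v - h *: (A *m v))) taylor.
  apply: (le_trans (lerD step1 step2)); rewrite mulrA -mulrDl -mulrA ler_wpM2l//.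
  have := ler_euclid_normB v w; rewrite euclid_normB.
  have : c1 * h * euclid_norm v <= c1 * h * (2 * euclid_norm w).
    by rewrite ler_wpM2l// mulr_ge0.
  by lra.
have : c1 * h * h * g <= c1 * h * h * K by rewrite ler_wpM2l ?mulr_ge0// velocity_le.
have : c1 * c2 * h ^+ 2 * h <= c1 * c2 * h ^+ 2 * 1.
  by rewrite ler_wpM2l ?mulr_ge0// sqr_ge0.
by lra.
Qed.

(** Conversely, every [v] in [V] is the start of an Euler step to some [w] in [W]
    with [|w| <= (1 + c1 h) |v|]. *)
Lemma velocity_le_gap : h * g <= S + (2 * c1 ^+ 2 + c2) * h ^+ 2.
Proof.
apply: le_trans (_ : S * (1 + c1 * h) + c2 * h ^+ 2 <= _).
  have S0 : 0 <= S by exact: spectral_norm_ge0.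
  have k0 : 0 <= S * (1 + c1 * h) + c2 * h ^+ 2.
    by rewrite addr_ge0 ?mulr_ge0 ?addr_ge0 ?mulr_ge0// sqr_ge0.
  have [->|hn0] := eqVneq h 0.
    by rewrite mul0r mulr0 addr0 mulr1 expr0n/= mulr0 addr0.
  have hp : 0 < h by rewrite lt_def hn0.
  rewrite mulrC -ler_pdivlMr//.
  apply: spectral_norm_le => [|x]; first by rewrite divr_ge0.
  rewrite mulrAC ler_pdivlMr//.
  apply: le_trans (ler_wpM2l k0 (proj_le V x)).
  rewrite -!mulmxA; have := proj_mem V x; rewrite -/P.
  move: (P *m x) => {x} v vV; have [w wW [wv vw taylor]] := stepVW vV.
  have e : h *: ((1%:M - P) *m (A *m v)) =
      (1%:M - P) *m w - (1%:M - P) *m (w - v - h *: (A *m v)).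
    by rewrite (euler_step_proj w vV) addrK.
  have -> : euclid_norm ((1%:M - P) *m (A *m v)) * h =
      euclid_norm (h *: ((1%:M - P) *m (A *m v))).
    by rewrite euclid_normZ ger0_norm// mulrC.
  rewrite e; apply: (le_trans (euclid_normD _ _)); rewrite euclid_normN.
  rewrite mulrDl lerD//.
    have := spectral_norm_ub ((1%:M - P) *m Q) w.
    rewrite -mulmxA (proj_id wW) => /le_trans; apply; rewrite -mulrA ler_wpM2l//.
    have := euclid_normD (w - v) v; rewrite subrK; lra.
  exact: le_trans (proj_compl_le _ _) taylor.
have : S * (c1 * h) <= 2 * c1 * h * (c1 * h) by rewrite ler_wpM2r ?mulr_ge0// gap_le.
by lra.
Qed.

(** The two projectors differ by [P (1 - Q) - (1 - P) Q]; the norm of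
    [P (1 - Q)] is that of its transpose [(1 - Q) P]. *)
Lemma projector_diff x : euclid_norm ((P - Q) *m x) <= 4 * c1 * h * euclid_norm x.
Proof.
pose y := (1%:M - Q) *m x.
have yle : euclid_norm y <= euclid_norm x by exact: proj_compl_le.
have e : (P - Q) *m x = P *m y - (1%:M - P) *m (Q *m x).
  by rewrite /y !mulmxBl !mul1mx mulmxBr opprB addrA subrK.
have Py : euclid_norm (P *m y) <= c1 * h * euclid_norm y.
  have [Py0|Py0] := eqVneq (euclid_norm (P *m y)) 0.
    by rewrite Py0 !mulr_ge0// euclid_norm_ge0.
  have Pyp : 0 < euclid_norm (P *m y) by rewrite lt_def Py0 euclid_norm_ge0.
  rewrite -(ler_pM2r Pyp) -expr2 euclid_norm_sqr.
  have -> : dot (P *m y) (P *m y) = dot ((1%:M - Q) *m (P *m y)) y.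
    rewrite -proj_sym (proj_id (proj_mem V y)) proj_compl dotBl [dot (Q *m _) _]proj_sym.
    have -> : orthogonal_projector W *m y = 0.
      by rewrite /y proj_compl mulmxBr (proj_id (proj_mem W x)) subrr.
    by rewrite [dot _ 0]/dot mulmx0 mxE subr0.
  rewrite (le_trans (cauchy_schwarz _ _))// mulrAC ler_wpM2r ?euclid_norm_ge0//.
  by rewrite dist_to_W// proj_mem.
rewrite e (le_trans (euclid_normD _ _))// euclid_normN.
have Qx := dist_to_V (proj_mem W x).
have : c1 * h * euclid_norm y <= c1 * h * euclid_norm x by rewrite ler_wpM2l ?mulr_ge0.
have : c1 * h * euclid_norm (Q *m x) <= c1 * h * euclid_norm x.
  by rewrite ler_wpM2l ?mulr_ge0// proj_le.
have : 0 <= c1 * h * euclid_norm x by rewrite !mulr_ge0// euclid_norm_ge0.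
by move: Qx Py; rewrite -/Q; lra.
Qed.

Lemma velocity_lip (B : 'M[R]_d) L : 0 <= L ->
  (forall x, euclid_norm (B *m x) <= K * euclid_norm x) ->
  (forall x, euclid_norm ((B - A) *m x) <= L * h * euclid_norm x) ->
  `|spectral_norm ((1%:M - Q) *m B *m Q) - g| <= (8 * c1 * K + L) * h.
Proof.
move=> L0 BK BA; apply: spectral_norm_lip => [|x].
  by rewrite mulr_ge0// addr_ge0// !mulr_ge0.
have -> : ((1%:M - Q) *m B *m Q - (1%:M - P) *m A *m P) *m x =
    (P - Q) *m (B *m (Q *m x)) + (1%:M - P) *m ((B - A) *m (Q *m x))
    - (1%:M - P) *m (A *m ((P - Q) *m x)).
  rewrite !(mulmxBl, mulmxBr, mul1mx) -!mulmxA.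
  apply/matrixP => i j; rewrite !mxE.
  by ring.
have Qx := proj_le W x.
have t1 : euclid_norm ((P - Q) *m (B *m (Q *m x))) <= 4 * c1 * h * (K * euclid_norm x).
  rewrite (le_trans (projector_diff _))// ler_wpM2l ?mulr_ge0//.
  by rewrite (le_trans (BK _))// ler_wpM2l.
have t2 : euclid_norm ((1%:M - P) *m ((B - A) *m (Q *m x))) <= L * h * euclid_norm x.
  by rewrite (le_trans (proj_compl_le _ _))// (le_trans (BA _))// ler_wpM2l// mulr_ge0.
have t3 : euclid_norm ((1%:M - P) *m (A *m ((P - Q) *m x))) <=
    K * (4 * c1 * h * euclid_norm x).
  rewrite (le_trans (proj_compl_le _ _))// (le_trans (AK _))// ler_wpM2l//.
  exact: projector_diff.
apply: (le_trans (euclid_normD _ _)); rewrite euclid_normN.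
apply: (le_trans (lerD (euclid_normD _ _) t3)).
apply: (le_trans (lerD (lerD t1 t2) (lexx _))).
by lra.
Qed.

(** The angle exceeds the gap, its sine, by at most the square of the gap. *)
Lemma angle_velocity s : (0 < s)%N -> \dim V = s -> \dim W = s ->
  h <= 1 -> 4 * c1 * h <= 1 ->
  `|max_principal_angle s V W - h * g| <=
  (c2 + 2 * c1 * K + 2 * c1 * c2 + 6 * c1 ^+ 2) * h ^+ 2.
Proof.
move=> s0 Vs Ws h1 c1h.
have [sigma [sig0 sigS ->]] := max_principal_angleE s0 Vs Ws.
have Sle := gap_le; have S0 : 0 <= S by exact: spectral_norm_ge0.
have Shalf : 0 <= S <= 1 / 2 by rewrite S0/=; lra.
have /andP[Sa aS] := acos_sin_bounds sig0 Shalf sigS.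
have S2 : S ^+ 2 <= (2 * c1 * h) ^+ 2 by rewrite ler_sqr ?nnegrE// !mulr_ge0.
have up := gap_le_velocity h1; have lo := velocity_le_gap.
have k1 : 0 <= c1 ^+ 2 * h ^+ 2 by rewrite mulr_ge0 ?sqr_ge0.
have k2 : 0 <= c1 * K * h ^+ 2 by rewrite !mulr_ge0 ?sqr_ge0.
have k3 : 0 <= c1 * c2 * h ^+ 2 by rewrite !mulr_ge0 ?sqr_ge0.
by rewrite ler_norml; apply/andP; split; lra.
Qed.

End NearbySubspaces.

(** * Riemann sums of a Lipschitz function *)

Section RiemannSum.
Local Open Scope classical_set_scope.
Local Open Scope ring_scope.
Variable R : realType.
Notation mu := (@lebesgue_measure R).

Lemma Rintegral_near_cst (g : R -> R) (a b p m : R) : a <= b ->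
  mu.-integrable `[a, b] (EFin \o g) ->
  (forall t, a <= t <= b -> `|g t - p| <= m) ->
  `|\int[mu]_(t in `[a, b]) g t - (b - a) * p| <= (b - a) * m.
Proof.
move=> ab gi gp.
have cst_int (k : R) : \int[mu]_(t in `[a, b]) k = (b - a) * k.
  rewrite Rintegral_cst//= lebesgue_measure_itv/= lte_fin mulrC.
  by case: ltgtP ab => //= -> _; rewrite subrr.
have cst_intble (k : R) : mu.-integrable `[a, b] (EFin \o (fun=> k)).
  apply: continuous_compact_integrable; first exact: segment_compact.
  by apply: continuous_subspaceT => x; exact: cvg_cst.
rewrite ler_distl -mulrBr -mulrDr -!cst_int; apply/andP; split;
  by apply: le_Rintegral => //= t; rewrite in_itv/= => /gp; rewrite ler_distl => /andP[].
Qed.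

Variables (g : R -> R) (h L : R).
Hypotheses (h0 : 0 < h) (L0 : 0 <= L).
Hypothesis g_lip : forall a b : R, 0 <= a <= b -> b - a <= h ->
  `|g b - g a| <= L * (b - a).

Lemma locally_lipschitz_continuous T : {within `[0, T], continuous g}.
Proof.
apply/subspace_continuousP => t; rewrite /= in_itv/= => /andP[t0 tT].
apply/cvgrPdist_lt => e e0.
have L1 : 0 < 1 + L by rewrite ltr_wpDr.
rewrite near_withinE; near=> r; rewrite /= in_itv/= => /andP[r0 rT].
have rh : `|t - r| < h by near: r; exact: nbhsx_ballx.
have re : `|t - r| < e / (1 + L) by near: r; apply: nbhsx_ballx; rewrite divr_gt0.
apply: (@le_lt_trans _ _ (L * `|t - r|)); last first.
  by move: re; rewrite ltr_pdivlMr//; have := normr_ge0 (t - r); lra.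
have [tr|rt] := leP t r.
  move: rh; rewrite distrC [`|g _ - _|]distrC ger0_norm ?subr_ge0// => rh.
  by apply: g_lip; rewrite ?t0//= ltW.
have tr0 : 0 <= t - r by rewrite subr_ge0 ltW.
move: rh; rewrite (ger0_norm tr0) => rh.
by apply: g_lip; [rewrite r0 ltW|rewrite ltW].
Unshelve. all: by end_near. Qed.

(** On each window both [theta j] and the integral of [g] are [O(h^2)] close to
    [h * g (j h)]. *)
Lemma riemann_sum_error (theta : nat -> R) c N :
  (forall j, `|theta j - h * g (j%:R * h)| <= c * h ^+ 2) ->
  `|\sum_(j < N) theta j - \int[mu]_(t in `[0, N%:R * h]) g t|
  <= N%:R * ((c + L) * h ^+ 2).
Proof.
move=> tg.
have gi (a b : R) : 0 <= a -> mu.-integrable `[a, b] (EFin \o g).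
  move=> a0; apply: continuous_compact_integrable; first exact: segment_compact.
  apply: continuous_subspaceW (locally_lipschitz_continuous (T := b)).
  by apply: subset_itvr; rewrite bnd_simp.
elim: N => [|N IH].
  by rewrite big_ord0 !mul0r set_itv1 Rintegral_set1 subrr normr0.
have Nh0 : 0 <= N%:R * h by rewrite mulr_ge0// ltW.
have NN1 : N.+1%:R * h = N%:R * h + h by rewrite -natr1 mulrDl mul1r.
rewrite big_ord_recr/=.
have split_int : \int[mu]_(t in `[0, N.+1%:R * h]) g t =
    \int[mu]_(t in `[0, N%:R * h]) g t +
    \int[mu]_(t in `[N%:R * h, N%:R * h + h]) g t.
  have := @Rintegral_itvB R g (BLeft 0) (BRight (N.+1%:R * h)) (N%:R * h).
  rewrite !bnd_simp NN1 lerDl (ltW h0) Nh0 gi// => /(_ isT isT isT) e.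
  rewrite -(@Rintegral_itv_obnd_cbnd _ (N%:R * h)); first by rewrite -e addrCA subrr addr0.
  apply: integrableS (gi 0 (N%:R * h + h) (lexx 0)) => //.
  by apply: subset_itvr; rewrite bnd_simp.
have cell : `|\int[mu]_(t in `[N%:R * h, N%:R * h + h]) g t - h * g (N%:R * h)|
    <= h * (L * h).
  have gp t : N%:R * h <= t <= N%:R * h + h -> `|g t - g (N%:R * h)| <= L * h.
    move=> /andP[Nt tN]; apply: (@le_trans _ _ (L * (t - N%:R * h))).
      by apply: g_lip; [rewrite Nh0|rewrite lerBlDl].
    by rewrite ler_wpM2l// lerBlDl.
  have := Rintegral_near_cst _ (gi _ _ Nh0) gp.
  by rewrite lerDl (ltW h0) => /(_ isT); rewrite addrAC subrr add0r.
rewrite split_int -natr1; move: IH cell (tg N) => IH cell tgN.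
rewrite (_ : _ - _ = (\sum_(i < N) theta i - \int[mu]_(t in `[0, N%:R * h]) g t)
  - (\int[mu]_(t in `[N%:R * h, N%:R * h + h]) g t - h * g (N%:R * h))
  + (theta N - h * g (N%:R * h))); last by ring.
apply: le_trans (ler_normD _ _) _.
apply: (le_trans (lerD (ler_normB _ _) tgN)).
apply: (le_trans (lerD (lerD IH cell) (lexx _))).
by lra.
Qed.

End RiemannSum.

(** * The subspaces transported by the flow *)

Section TransportedSubspaces.
Variables (R : realType) (d : nat) (A : R -> 'M[R]_d) (K L : R).
Hypotheses (K0 : 0 <= K) (L0 : 0 <= L).
Hypothesis AK : forall t, 0 <= t ->
  forall x, euclid_norm (A t *m x) <= K * euclid_norm x.
Hypothesis AL : forall t r, 0 <= t <= r ->
  forall x, euclid_norm ((A r - A t) *m x) <= L * (r - t) * euclid_norm x.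

(* The constants of [solution_increment] and [solution_taylor]. *)
Let c1 := 2 * d%:R * K.
Let c2 := d%:R * (2 * L + K * c1).

(** On a short window the norm at most doubles backwards in time, and finitely
    many short windows lead from [t] to [0]. *)
Lemma solution_eq0 u t : solution A u -> 0 <= t -> u t = 0 -> u 0 = 0.
Proof.
move=> u_sol t0 ut.
have c1t0 : 0 <= 2 * (c1 * t) by rewrite !mulr_ge0.
set n := (Num.bound (2 * (c1 * t))).+1.
have n0 : 0 < n%:R :> R by rewrite ltr0n.
have tn : 2 * (c1 * t) <= n%:R.
  by rewrite (le_trans (ltW (archi_boundP c1t0)))// ler_nat leqnSn.
pose eta := t / n%:R.
have eta0 : 0 <= eta by rewrite divr_ge0// ltW.
suff back k : u (k%:R * eta) = 0 -> u 0 = 0.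
  by apply: (back n); rewrite /eta mulrC mulfVK ?gt_eqF.
elim: k => [|k IH]; first by rewrite mul0r.
move=> uk1; apply/IH/euclid_norm_eq0/eqP.
have ab0 : 0 <= k%:R * eta <= k.+1%:R * eta.
  by rewrite mulr_ge0//= ler_wpM2r// ler_nat.
have short : c1 * (k.+1%:R * eta - k%:R * eta) <= 1 / 2.
  rewrite (_ : c1 * _ = c1 * t / n%:R); last by rewrite /eta -natr1; ring.
  by rewrite ler_pdivrMr//; lra.
have := solution_window_ge K0 AK ab0 u_sol short.
by rewrite uk1 euclid_norm0 mulr0 eq_le euclid_norm_ge0 andbT.
Qed.

Variable Phi : R -> R -> 'M[R]_d.
Hypothesis hPhi : solution_operator A Phi.

Lemma flow_solution v : solution A (fun t => Phi t 0 *m v).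
Proof. by have [_ + t t0] := hPhi v (lexx 0); apply. Qed.

Lemma flow_dim (V : {vspace 'cV[R]_d}) (t : R) : 0 <= t ->
  \dim (image_by (Phi t 0) V) = \dim V.
Proof.
move=> t0; apply: limg_dim_eq; apply/eqP; rewrite -subv0.
apply/subvP => v; rewrite memv_cap memv_ker lfunE/= memv0 => /andP[_ /eqP vt].
have := solution_eq0 (@flow_solution v) t0 vt.
by have [-> _] := hPhi v (lexx 0) => ->.
Qed.

Lemma mem_image_byP (V : {vspace 'cV[R]_d}) (M : 'M[R]_d) w :
  reflect (exists2 v, v \in V & w = M *m v) (w \in image_by M V).
Proof.
apply: (iffP memv_imgP) => -[v vV ->]; exists v => //; by rewrite lfunE.
Qed.

Variables (V : {vspace 'cV[R]_d}) (s : nat).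
Hypotheses (s0 : (0 < s)%N) (Vs : \dim V = s).

Let Vt t := image_by (Phi t 0) V.
Let g t := let P := orthogonal_projector (image_by (Phi t 0) V) in
  spectral_norm ((1%:M - P) *m A t *m P).

Section Window.
Variables a b : R.
Hypotheses (ab0 : 0 <= a <= b) (short : c1 * (b - a) <= 1 / 4).

Let step v : euler_step (A a) (b - a) c1 c2 (Phi a 0 *m v) (Phi b 0 *m v).
Proof.
have u_sol := @flow_solution v.
have short2 : c1 * (b - a) <= 1 / 2 by move: short; lra.
split.
- have := solution_increment K0 AK ab0 u_sol short2 (c := b).
  by have [_ ab] := andP ab0; rewrite ab lexx => /(_ isT).
- exact (solution_window_ge K0 AK ab0 u_sol short2).
- exact (solution_taylor K0 L0 AK AL ab0 u_sol short2).
Qed.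

Let step_to v : v \in Vt a ->
  exists2 w, w \in Vt b & euler_step (A a) (b - a) c1 c2 v w.
Proof.
move=> /mem_image_byP[v0 v0V ->]; exists (Phi b 0 *m v0); last exact: step.
by apply/mem_image_byP; exists v0.
Qed.

Let step_from w : w \in Vt b ->
  exists2 v, v \in Vt a & euler_step (A a) (b - a) c1 c2 v w.
Proof.
move=> /mem_image_byP[v0 v0V ->]; exists (Phi a 0 *m v0); last exact: step.
by apply/mem_image_byP; exists v0.
Qed.

Let a0 : 0 <= a. Proof. by have [] := andP ab0. Qed.
Let b0 : 0 <= b. Proof. by have [_ ab] := andP ab0; exact: le_trans a0 ab. Qed.
Let ba0 : 0 <= b - a. Proof. by have [_ ab] := andP ab0; rewrite subr_ge0. Qed.
Let c10 : 0 <= c1. Proof. by rewrite !mulr_ge0. Qed.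
Let c20 : 0 <= c2. Proof. by rewrite mulr_ge0// addr_ge0 ?mulr_ge0. Qed.

Lemma velocity_lipschitz : `|g b - g a| <= (8 * c1 * K + L) * (b - a).
Proof.
exact (velocity_lip ba0 c10 K0 (AK a0) step_to step_from L0 (AK b0) (AL ab0)).
Qed.

Lemma angle_step : b - a <= 1 ->
  `|max_principal_angle s (Vt a) (Vt b) - (b - a) * g a| <=
  (c2 + 2 * c1 * K + 2 * c1 * c2 + 6 * c1 ^+ 2) * (b - a) ^+ 2.
Proof.
move=> ba1; have Va : \dim (Vt a) = s by rewrite flow_dim.
have Vb : \dim (Vt b) = s by rewrite flow_dim.
have c1ba : 4 * c1 * (b - a) <= 1 by move: short; lra.
exact (angle_velocity ba0 c10 c20 K0 (AK a0) step_to step_from s0 Va Vb ba1 c1ba).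
Qed.

End Window.

Lemma step_cont_error T N (h := T / N%:R) : 0 < T -> (0 < N)%N -> h <= 1 ->
  c1 * h <= 1 / 4 ->
  `|alpha_step s Phi N T V - alpha_cont A Phi T V| <=
  (c2 + 10 * c1 * K + 2 * c1 * c2 + 6 * c1 ^+ 2 + L) * h.
Proof.
move=> T0 N0 h1 c1h.
have Np : 0 < N%:R :> R by rewrite ltr0n.
have h0 : 0 < h by rewrite divr_gt0.
have hT : N%:R * h = T by rewrite /h mulrC divfK// gt_eqF.
have c10 : 0 <= c1 by rewrite !mulr_ge0.
pose L' := 8 * c1 * K + L.
have L'0 : 0 <= L' by rewrite addr_ge0// !mulr_ge0.
have g_lip a b : 0 <= a <= b -> b - a <= h -> `|g b - g a| <= L' * (b - a).
  move=> ab0 bah; apply: velocity_lipschitz => //.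
  by rewrite (le_trans _ c1h)// ler_wpM2l.
pose theta j := max_principal_angle s (Vt (j%:R * h)) (Vt (j.+1%:R * h)).
pose c := c2 + 2 * c1 * K + 2 * c1 * c2 + 6 * c1 ^+ 2.
have theta_le j : `|theta j - h * g (j%:R * h)| <= c * h ^+ 2.
  have hE : j.+1%:R * h - j%:R * h = h by rewrite -natr1; ring.
  have := @angle_step (j%:R * h) (j.+1%:R * h); rewrite hE; apply=> //.
  by rewrite mulr_ge0 ?(ltW h0)//= ler_wpM2r ?(ltW h0)// ler_nat.
have := riemann_sum_error h0 L'0 g_lip N theta_le.
rewrite hT => err.
rewrite /alpha_step /alpha_cont -/h -mulrBr normrM gtr0_norm ?invr_gt0//.
rewrite mulrC ler_pdivrMr//.
rewrite big_add1/= big_mkord.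
rewrite (eq_bigr (fun j : 'I_N => theta j)); last first.
  by move=> j _; rewrite -[in X in X - 1]natr1 addrK.
by apply: le_trans err _; rewrite -hT /c /L'; lra.
Qed.

End TransportedSubspaces.

Theorem theorem4p3 (R : realType) (d s : nat) (hs : (0 < s <= d)%N)
    (A : R -> 'M[R]_d) (hA : Cb1 A)
    (Phi : R -> R -> 'M[R]_d) (hPhi : solution_operator A Phi) :
  exists C h0 : R, [/\ 0 < C, 0 < h0 &
    forall V : {vspace 'cV[R]_d}, \dim V = s ->
    forall T : R, 0 < T ->
    forall N : nat, (0 < N)%N -> T / N%:R <= h0 ->
      `|alpha_step s Phi N T V - alpha_cont A Phi T V| <= C * (T / N%:R)].
Proof.
have [K [L [K0 L0 AK AL]]] := Cb1_bounds hA.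
have [s0 _] := andP hs.
set c1 := 2 * d%:R * K; set c2 := d%:R * (2 * L + K * c1).
have c10 : 0 <= c1 by rewrite !mulr_ge0.
have c20 : 0 <= c2 by rewrite mulr_ge0// addr_ge0 ?mulr_ge0.
set c := c2 + 10 * c1 * K + 2 * c1 * c2 + 6 * c1 ^+ 2 + L.
have c0 : 0 <= c.
  have c1K := mulr_ge0 c10 K0; have c12 := mulr_ge0 c10 c20.
  by have := sqr_ge0 c1; rewrite /c; lra.
have k0 : 0 < 1 + 4 * c1 by rewrite ltr_wpDr// mulr_ge0.
exists (c + 1), (1 + 4 * c1)^-1; split; first by rewrite ltr_wpDl.
  by rewrite invr_gt0.
move=> V Vs T T0 N N0 hle.
have {}hle : T / N%:R * (1 + 4 * c1) <= 1 by rewrite -ler_pdivlMr// mul1r.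
have h0 : 0 < T / N%:R by rewrite divr_gt0// ltr0n.
have ch0 : 0 <= T / N%:R * c1 by rewrite mulr_ge0// ltW.
have h1 : T / N%:R <= 1 by lra.
have ch1 : c1 * (T / N%:R) <= 1 / 4 by lra.
apply: le_trans (step_cont_error K0 L0 AK AL hPhi s0 Vs T0 N0 h1 ch1) _.
by rewrite ler_wpM2r ?ltW// -/c ltrDl.
Qed.
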